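(* Achronal localizations (AL) and representations of the causal logic (RCL) on a separable Hilbert space $\mathcal{H}$ are equivalent: (i) if $F$ is an RCL on $\mathcal{H}$, then $T(\Delta):=F(\Delta^\wedge)$, $\Delta\in\mathcal{B}^{ach}$, defines an AL on $\mathcal{H}$; (ii) if $T$ is an AL on $\mathcal{H}$, then there is a unique RCL $F$ on $\mathcal{H}$ with $F(\Delta^\wedge)=T(\Delta)$ for all $\Delta\in\mathcal{B}^{ach}$.
   Context: **Minkowski space.** Points of $\mathbb{R}^4$ are $\mathfrak{x}=(x_0,x)$, $x\in\mathbb{R}^3$; $\mathfrak{a}\cdot\mathfrak{b}:=a_0b_0-a_1b_1-a_2b_2-a_3b_3$, $\mathfrak{a}^{\cdot 2}:=\mathfrak{a}\cdot\mathfrak{a}$. **AL.** A set $\Delta\subset\mathbb{R}^4$ is achronal if $(\mathfrak{x}-\mathfrak{y})^{\cdot2}\le0$ for all $\mathfrak{x},\mathfrak{y}\in\Delta$; maximal achronal if it is achronal and not properly contained in an achronal set. $\mathcal{B}^{ach}$ is the set of achronal Borel subsets of $\mathbb{R}^4$. An achronal localization (AL) on $\mathcal{H}$ is a map $T$ assigning to each $\Delta\in\mathcal{B}^{ach}$ a nonnegative bounded operator $T(\Delta)$ on $\mathcal{H}$ with $T(\emptyset)=0$ and $\sum_nT(\Delta_n)=I$ for every sequence $(\Delta_n)$ of mutually disjoint sets in $\mathcal{B}^{ach}$ such that $\bigcup_n\Delta_n$ is maximal achronal. **RCL.** $\mathfrak{x}\perp\mathfrak{y}$ iff $\mathfrak{x}\neq\mathfrak{y}$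 and $(\mathfrak{x}-\mathfrak{y})^{\cdot2}\le0$. For $M\subset\mathbb{R}^4$, $M^\perp:=\{\mathfrak{x}:\mathfrak{x}\perp\mathfrak{y}\ \forall\mathfrak{y}\in M\}$, $M^\wedge:=(M^\perp)^\perp$; $M$ is $\perp$-complete if $M=M^\wedge$. The causal logic $\mathcal{C}$ is the set of all $\perp$-complete Borel subsets of $\mathbb{R}^4$ (for $\Delta$ Borel, $\Delta^\wedge$ is Borel, so $\Delta^\wedge\in\mathcal{C}$). Sets $M,N$ are orthogonal if $\mathfrak{x}\perp\mathfrak{y}$ for all $\mathfrak{x}\in M,\mathfrak{y}\in N$; $\bigvee_nM_n:=(\bigcup_nM_n)^\wedge$. A representation of the causal logic (RCL) on $\mathcal{H}$ is a map $F$ assigning to each $M\in\mathcal{C}$ a nonnegative bounded operator $F(M)$ on $\mathcal{H}$ with $F(\emptyset)=0$ and $\sum_nF(M_n)=I$ for every sequence $(M_n)$ of mutually orthogonal sets in $\mathcal{C}$ with $\bigvee_nM_n=\mathbb{R}^4$. *)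

(* Defs.v *)
From HB Require Import structures.
From mathcomp Require Import all_boot all_order all_algebra.
From mathcomp Require Import complex.
From mathcomp Require Import all_classical all_reals all_analysis.

Set Implicit Arguments.
Unset Strict Implicit.
Unset Printing Implicit Defensive.

Import Order.TTheory GRing.Theory Num.Theory.
Import numFieldNormedType.Exports.

Local Open Scope classical_set_scope.
Local Open Scope complex_scope.
Local Open Scope ring_scope.

Section Minkowski.
Variable R : realType.

Implicit Types (x y : 'rV[R]_4) (M N : set 'rV[R]_4).

(* Coordinate 0 is time, coordinates [lift ord0 i], i < 3, are space. *)
Definition mdot x y : R :=
  x 0 ord0 * y 0 ord0 - \sum_(i < 3) x 0 (lift ord0 i) * y 0 (lift ord0 i).

Definition borel M : Prop := <<s @open 'rV[R]_4 >> M.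

Definition achronal M : Prop :=
  forall x y, M x -> M y -> mdot (x - y) (x - y) <= 0.

Definition maximal_achronal M : Prop :=
  achronal M /\ forall N, achronal N -> M `<=` N -> N = M.

(* Lightlike separated points are orthogonal, timelike ones are not. *)
Definition orth x y : Prop := x <> y /\ mdot (x - y) (x - y) <= 0.

Definition perp M : set 'rV[R]_4 := [set x | forall y, M y -> orth x y].

Definition wedge M : set 'rV[R]_4 := perp (perp M).

Definition orth_sets M N : Prop := forall x y, M x -> N y -> orth x y.

Record achronalBorel := AchronalBorel {
  achronal_set :> set 'rV[R]_4 ;
  achronal_setP : borel achronal_set /\ achronal achronal_set }.

Record causalLogic := CausalLogic {
  causal_set :> set 'rV[R]_4 ;
  causal_setP : borel causal_set /\ wedge causal_set = causal_set }.

Lemma mdot_continuous y : continuous (fun x => mdot (x - y) (x - y)).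
Proof.
have cc (j : 'I_4) : continuous (fun x => (x - y) 0 j).
  have -> : (fun x => (x - y) 0 j) = (fun x => x 0 j - y 0 j).
    by apply/funext => x; rewrite !mxE.
  move=> x; apply: (@cvgB _ R _ (nbhs x) _ (fun z : 'rV[R]_4 => z 0 j)).
    exact: (@coord_continuous R 1 4 0 j x).
  exact: cvg_cst.
move=> x; apply: (@cvgB _ R _ (nbhs x) _ (fun z => (z - y) 0 ord0 * _)).
  by apply: cvgM; exact: cc.
apply: (@cvg_big _ _ _ _ _ (@add_continuous R)) => i _.
  by apply: cvgM; exact: cc.
Qed.

Lemma borel_perp M : borel M -> borel (perp M).
Proof.
move=> bM.
pose I := \bigcup_(y in M) [set x | 0 < mdot (x - y) (x - y)].
have oI : open I.
  apply: bigcup_open => y _.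
  apply: (@open_comp _ _ (fun x => mdot (x - y) (x - y)) [set r | 0 < r]).
    by move=> x _; exact: mdot_continuous.
  exact: open_gt.
have -> : perp M = ~` (M `|` I).
  apply/seteqP; split=> [x px [Mx|[y My /=]]|x nx y My].
  - by have [] := px x Mx.
  - by have [_] := px y My; rewrite leNgt => /negP.
  - split=> [xy|]; first by apply: nx; left; rewrite xy.
    by rewrite leNgt; apply/negP => lt0; apply: nx; right; exists y.
rewrite -setTD; apply: sigma_algebraCD.
rewrite -bigcup2E; apply: sigma_algebra_bigcup => -[|[|n]] //=.
- exact: sub_sigma_algebra.
- exact: sigma_algebra0.
Qed.

Lemma wedgeK M : wedge (wedge M) = wedge M.
Proof.
have orthC x y : orth x y -> orth y x.
  move=> [ne le0]; split; first exact/nesym.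
  suff -> : mdot (y - x) (y - x) = mdot (x - y) (x - y) by [].
  rewrite /mdot; congr (_ - _); last apply: eq_bigr => i _.
    by rewrite !mxE -mulrNN !opprB.
  by rewrite !mxE -mulrNN !opprB.
have sub N : N `<=` wedge N by move=> x Nx y py; apply/orthC; exact: py.
apply/seteqP; split; last exact: sub.
by move=> x wx y py; apply: wx; apply: sub.
Qed.

Lemma borel_set0 : borel set0.
Proof. exact: sigma_algebra0. Qed.

Lemma wedge0 : wedge set0 = set0.
Proof. by rewrite -subset0 => x /(_ x) []. Qed.

Lemma achronal0 : achronal set0.
Proof. by []. Qed.

Definition achronalBorel0 : achronalBorel :=
  AchronalBorel (conj borel_set0 achronal0).

Definition causalLogic0 : causalLogic :=
  CausalLogic (conj borel_set0 wedge0).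

Definition causal_hull (D : achronalBorel) : causalLogic :=
  CausalLogic
    (conj (borel_perp (borel_perp (proj1 (achronal_setP D)))) (wedgeK D)).

End Minkowski.

Definition separable (T : topologicalType) : Prop :=
  exists S : set T, countable S /\ dense S.

Section Localizations.
Variables (R : realType) (H : completeNormedModType R[i]).
(* The inner product, linear in its first argument; that it induces the norm
   of H is the hypothesis [inner_product_norm]. *)
Variable dot : {dot H for Num.conj}.

Definition inner_product_norm : Prop := forall u : H, `|u| ^+ 2 = dot u u.

(* For z : R[i], [0 <= z] means that z is real and nonnegative. *)
Definition nonneg_bounded_operator (A : H -> H) : Prop :=
  [/\ linear A,
      exists C : R[i], forall u, `|A u| <= C * `|u|
    & forall u, 0 <= dot (A u) u].

(* The sum converges to the identity in the strong operator topology. *)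
Definition sums_to_id (A : nat -> H -> H) : Prop :=
  forall u : H, series (fun n => A n u) @ \oo --> u.

Definition AL (T : achronalBorel R -> H -> H) : Prop :=
  [/\ forall D, nonneg_bounded_operator (T D),
      T (achronalBorel0 R) = (fun=> 0)
    & forall D : nat -> achronalBorel R,
        (forall m n, m <> n -> D m `&` D n = set0) ->
        maximal_achronal (\bigcup_n D n) ->
        sums_to_id (fun n => T (D n))].

Definition RCL (F : causalLogic R -> H -> H) : Prop :=
  [/\ forall M, nonneg_bounded_operator (F M),
      F (causalLogic0 R) = (fun=> 0)
    & forall M : nat -> causalLogic R,
        (forall m n, m <> n -> orth_sets (M m) (M n)) ->
        wedge (\bigcup_n M n) = [set: 'rV[R]_4] ->
        sums_to_id (fun n => F (M n))].

End Localizations.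

(* Main.v *)
(** Timelike order is transitive and open, which makes causal completeness
    behave well along timelike segments: if Delta is maximal among the achronal
    subsets of a complete set M, then M is the completion of Delta (the causal
    logic is orthomodular).  Extending Delta to a maximal achronal, hence
    closed, set Lambda of the whole space shows that Delta = Lambda `&` M is
    Borel.  So every element of the logic is the completion of an achronal
    Borel set, and F is determined by T.  Conversely T Delta depends only on
    the completion of Delta: if Delta and Gamma partition a maximal achronal
    set and Delta' has the same completion as Delta, then Delta' and Gamma
    partition a maximal achronal set as well, so both values equal
    1 - T Gamma. *)
Require Import Defs.
From mathcomp Require Import all_boot all_order all_algebra.
From mathcomp Require Import complex lra ring.
From mathcomp Require Import all_classical all_reals all_analysis.

Import Order.TTheory GRing.Theory Num.Theory.
Import numFieldNormedType.Exports.

Local Open Scope classical_set_scope.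
Local Open Scope complex_scope.
Local Open Scope ring_scope.

Section CausalGeometry.

Set Implicit Arguments.
Unset Strict Implicit.
Unset Printing Implicit Defensive.

Variable R : realType.
Implicit Types (u v w x y z d : 'rV[R]_4) (M N D : set 'rV[R]_4) (s e : R).

(** * The Minkowski form and the timelike order *)

Lemma mdotE x y : mdot x y = x 0 ord0 * y 0 ord0 -
  (x 0 (lift ord0 ord0) * y 0 (lift ord0 ord0) +
   x 0 (lift ord0 (lift ord0 ord0)) * y 0 (lift ord0 (lift ord0 ord0)) +
   x 0 (lift ord0 (lift ord0 (lift ord0 ord0))) *
   y 0 (lift ord0 (lift ord0 (lift ord0 ord0)))).
Proof. by rewrite /mdot !big_ord_recl big_ord0 addr0 !addrA. Qed.

Lemma mdotNN x : mdot (- x) (- x) = mdot x x.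
Proof. by rewrite !mdotE !mxE !mulrNN. Qed.

Lemma mdotDD x y : mdot (x + y) (x + y) = mdot x x + 2 * mdot x y + mdot y y.
Proof. by rewrite !mdotE !mxE; ring. Qed.

Lemma mdot_combination (a b : R) x y :
  mdot (a *: x - b *: y) (a *: x - b *: y) =
  a ^+ 2 * mdot x x - 2 * (a * b) * mdot x y + b ^+ 2 * mdot y y.
Proof. by rewrite !mdotE !mxE; ring. Qed.

Lemma mdot_le0 w : w 0 ord0 = 0 -> mdot w w <= 0.
Proof.
move=> w0; rewrite /mdot w0 mul0r sub0r oppr_le0.
by apply: sumr_ge0 => i _; rewrite -expr2 sqr_ge0.
Qed.

(* The vector [v_0 u - u_0 v] has no time component, hence is not timelike. *)
Lemma mdot_timelike_gt0 u v : 0 < mdot u u -> 0 < mdot v v ->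
  0 < u 0 ord0 * v 0 ord0 -> 0 < mdot u v.
Proof.
move=> u0 v0 uv.
have : mdot (v 0 ord0 *: u - u 0 ord0 *: v) (v 0 ord0 *: u - u 0 ord0 *: v) <= 0.
  by apply: mdot_le0; rewrite !mxE; ring.
rewrite mdot_combination => le0.
have un0 : u 0 ord0 != 0 by apply: contraTneq uv => ->; rewrite mul0r ltxx.
have vn0 : v 0 ord0 != 0 by apply: contraTneq uv => ->; rewrite mulr0 ltxx.
have A : 0 < v 0 ord0 ^+ 2 * mdot u u by rewrite mulr_gt0 // exprn_even_gt0.
have B : 0 < u 0 ord0 ^+ 2 * mdot v v by rewrite mulr_gt0 // exprn_even_gt0.
have : 0 < (u 0 ord0 * v 0 ord0) * mdot u v by lra.
by rewrite pmulr_rgt0.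
Qed.

(* The sign of [s] is a choice of time orientation. *)
Definition timelike_dir s u : Prop := 0 < mdot u u /\ 0 < s * u 0 ord0.

Definition precedes s x y : Prop := timelike_dir s (y - x).

(** The cross term of the square is positive because both vectors point to the same side in time.
    This yields transitivity of [precedes]. *)
Lemma timelike_dirD s u v :
  timelike_dir s u -> timelike_dir s v -> timelike_dir s (u + v).
Proof.
move=> [uu su] [vv sv]; split; last by rewrite mxE mulrDr addr_gt0.
have uv : 0 < u 0 ord0 * v 0 ord0.
  have := mulr_gt0 su sv.
  rewrite mulrACA -expr2 pmulr_rgt0 // exprn_even_gt0 //=.
  by apply: contraTneq su => ->; rewrite mul0r ltxx.
by rewrite mdotDD; have := mdot_timelike_gt0 uu vv uv; lra.
Qed.

Lemma timelike_dirZ s e u :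
  0 < e -> timelike_dir s u -> timelike_dir s (e *: u).
Proof.
move=> e0 [uu su]; split.
  have -> : mdot (e *: u) (e *: u) = e ^+ 2 * mdot u u.
    by rewrite !mdotE !mxE; ring.
  by rewrite mulr_gt0 // exprn_gt0.
by rewrite mxE mulrCA mulr_gt0.
Qed.

Lemma timelike_dir_open s u d : timelike_dir s u -> timelike_dir s d ->
  exists2 e, 0 < e & forall e', 0 <= e' <= e -> timelike_dir s (u - e' *: d).
Proof.
move=> [uu su] [dd sd].
have sB : 0 < 2 * `|mdot u d| + 1 by rewrite ltr_wpDl // mulr_ge0.
(* Half of [e1] keeps the quadratic form positive, the [+ 1] guarding against [mdot u d = 0]; [e2]
   is half the factor at which the time component of [u - e' *: d] vanishes. *)
pose e1 := mdot u u / (2 * `|mdot u d| + 1).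
pose e2 := s * u 0 ord0 / (2 * (s * d 0 ord0)).
have e10 : 0 < e1 by rewrite divr_gt0.
have e20 : 0 < e2 by apply: divr_gt0 => //; apply: mulr_gt0.
exists (Num.min (e1 / 2) e2); first by rewrite lt_min e20 divr_gt0.
move=> e' /andP[e'0]; rewrite le_min => /andP[le1 le2]; split.
  have -> : u - e' *: d = 1 *: u - e' *: d by rewrite scale1r.
  rewrite mdot_combination expr1n !mul1r.
  have le1' : e' * (2 * `|mdot u d| + 1) <= mdot u u / 2.
    rewrite -ler_pdivlMr //; apply: (le_trans le1).
    by rewrite /e1 mulrAC.
  have udn : e' * mdot u d <= e' * `|mdot u d| by rewrite ler_wpM2l // ler_norm.
  have dd2 : 0 <= e' ^+ 2 * mdot d d by rewrite mulr_ge0 ?sqr_ge0 ?ltW.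
  lra.
have sd2 : 0 < 2 * (s * d 0 ord0) by apply: mulr_gt0.
move: le2; rewrite /e2 ler_pdivlMr // => le2.
by rewrite !mxE; lra.
Qed.

Lemma precedes_trans s y x z :
  precedes s x y -> precedes s y z -> precedes s x z.
Proof.
move=> xy yz; have := timelike_dirD yz xy.
by rewrite /precedes addrA subrK.
Qed.

Lemma orth_sym x y : orth x y -> orth y x.
Proof. by move=> [ne le0]; split; [exact/nesym|rewrite -mdotNN opprB]. Qed.

Lemma precedes_not_orth s x y : precedes s x y -> ~ orth x y.
Proof.
by move=> [gt0 _] [_]; rewrite -mdotNN opprB leNgt gt0.
Qed.

Lemma not_orth_cases s x y : s != 0 -> ~ orth x y ->
  [\/ x = y, precedes s x y | precedes s y x].
Proof.
move=> s0 nxy; have [<-|/eqP xny] := eqVneq x y; first by constructor 1.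
have gt0 : 0 < mdot (x - y) (x - y).
  by rewrite ltNge; apply/negP => le0; apply: nxy.
have t0 : (x - y) 0 ord0 != 0.
  by apply: contraTneq gt0 => /mdot_le0; rewrite leNgt.
have := mulf_neq0 s0 t0; rewrite neq_lt => /orP[lt0|lt0].
  constructor 2; split; first by rewrite -mdotNN opprB.
  by rewrite -opprB mxE mulrN oppr_gt0.
by constructor 3.
Qed.

(** * Orthocomplements and achronal sets *)

Lemma sub_wedge M : M `<=` wedge M.
Proof. by move=> x Mx y py; apply/orth_sym/py. Qed.

Lemma perpS M N : M `<=` N -> perp N `<=` perp M.
Proof. by move=> MN x px y /MN /px. Qed.

Lemma perp_wedge M : perp (wedge M) = perp M.
Proof.
by apply/seteqP; split; [exact/perpS/sub_wedge|exact: sub_wedge].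
Qed.

Lemma perp_bigcup (A : nat -> set 'rV[R]_4) :
  perp (\bigcup_n A n) = \bigcap_n perp (A n).
Proof.
apply/seteqP; split=> [x px n _ y Ay|x px y [n _ Ay]]; last exact: (px n).
by apply: px; exists n.
Qed.

Lemma perp_eq0_wedge M : perp M = set0 -> wedge M = setT.
Proof. by rewrite /wedge => ->; rewrite -subTset => x _ y. Qed.

Lemma perp_setT : perp [set: 'rV[R]_4] = set0.
Proof. by rewrite -subset0 => x /(_ x I) []. Qed.

Lemma achronal_orth M x y : achronal M -> M x -> M y -> x <> y -> orth x y.
Proof. by move=> aM Mx My ne; split=> //; exact: aM. Qed.

Lemma orth_achronal M :
  (forall x y, M x -> M y -> x <> y -> orth x y) -> achronal M.
Proof.
move=> oM x y Mx My; have [->|/eqP ne] := eqVneq x y; last by case: (oM x y).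
by rewrite subrr; apply: mdot_le0; rewrite mxE.
Qed.

Lemma achronalS M N : M `<=` N -> achronal N -> achronal M.
Proof. by move=> MN aN x y Mx My; apply: aN; exact: MN. Qed.

Lemma achronalU1 M x : achronal M -> perp M x -> achronal (x |` M).
Proof.
move=> aM px; apply: orth_achronal => y z [->|My] [->|Mz] // ne.
- exact: px.
- exact/orth_sym/px.
- exact: (achronal_orth aM).
Qed.

(** A point of [perp M] could be added to [M]; conversely, a point of a larger achronal set that is
    not in [M] lies in [perp M]. *)
Lemma maximal_achronalP M :
  maximal_achronal M <-> achronal M /\ perp M = set0.
Proof.
split=> [[aM mM]|[aM pM]]; split=> //.
  rewrite -subset0 => x px.
  have : M x.
    by rewrite -(mM _ (achronalU1 aM px)); [left|exact: subsetUr].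
  by move=> /px [].
move=> N aN MN; apply/seteqP; split=> // x Nx.
apply: contrapT => nMx; suff : perp M x by rewrite pM.
move=> y My; apply: (achronal_orth aN) => //; first exact: MN.
by move=> xy; apply: nMx; rewrite xy.
Qed.

(** * Maximal achronal sets: existence and measurability *)

Lemma achronal_extension D M : achronal D -> D `<=` M ->
  exists L, [/\ D `<=` L, L `<=` M, achronal L &
    forall N, N `<=` M -> achronal N -> L `<=` N -> N = L].
Proof.
move=> aD DM.
(* [D] is joined to [A] instead of being required inside it, so that the empty chain, whose union is
   empty, is no exception. *)
pose P A := achronal (D `|` A) /\ A `<=` M.
have [|A [[aA AM] maxA]] := @Zorn_bigcup _ P.
  move=> F FP totF; split; last by move=> x [A /FP[_ AM] /AM].
  move=> x y [Dx|[A FA Ax]] [Dy|[B FB By]].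
  - exact: aD.
  - by apply: (FP _ FB).1; [left|right].
  - by apply: (FP _ FA).1; [right|left].
  - have [AB|BA] := totF _ _ FA FB.
      by apply: (FP _ FB).1; right => //; exact: AB.
    by apply: (FP _ FA).1; right => //; exact: BA.
exists (D `|` A); split=> //; first by rewrite subUset.
move=> N NM aN DAN; apply/seteqP; split=> //.
have [AN NA] : A `<=` N /\ (N `<=` A -> N `<=` D `|` A).
  by split=> [x Ax|NA x /NA]; [apply: DAN; right|right].
apply: NA; apply: contrapT => nNA; apply: (maxA N); first by split.
by split=> //; rewrite setUidr // => x Dx; apply: DAN; left.
Qed.

Lemma maximal_achronal_extension D :
  achronal D -> exists2 L, D `<=` L & maximal_achronal L.
Proof.
move=> aD; have [L [DL _ aL mL]] := achronal_extension aD (@subsetT _ D).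
by exists L => //; split=> // N aN LN; exact: mL.
Qed.

(** With one point fixed, achronality is a closed condition on the other, so the closure can be
    taken in one variable after the other. *)
Lemma achronal_closure M : achronal M -> achronal (closure M).
Proof.
pose C y := [set x : 'rV[R]_4 | mdot (x - y) (x - y) <= 0].
have cC y : closed (C y).
  apply: (@closed_comp _ _ (fun x => mdot (x - y) (x - y)) [set r | r <= 0]).
    by move=> x _; exact: mdot_continuous.
  exact: closed_le.
have CC x y : C y x -> C x y by rewrite /C /= -mdotNN opprB.
have clC N y : N `<=` C y -> closure N `<=` C y.
  move=> NC; rewrite [X in _ `<=` X]((closure_id _).1 (cC y)).
  exact: closureS.
move=> aM x y cx cy.
have {}cy z : M z -> C z y by move=> Mz; apply: clC cy => w Mw; exact: aM.
by apply: clC cx => z Mz; apply/CC/cy.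
Qed.

Lemma maximal_achronal_borel M : maximal_achronal M -> borel M.
Proof.
move=> [aM mM].
rewrite -(mM _ (achronal_closure aM) (@subset_closure _ M)).
rewrite -[closure M]setCK -setTD.
apply: sigma_algebraCD; apply: sub_sigma_algebra.
exact/closed_openC/closed_closure.
Qed.

Lemma borelI M N : borel M -> borel N -> borel (M `&` N).
Proof.
move=> bM bN.
rewrite -(setCK (M `&` N)) setCI -setTD; apply: sigma_algebraCD.
rewrite -bigcup2E; apply: sigma_algebra_bigcup => -[|[|n]] //=.
- by rewrite -setTD; exact: sigma_algebraCD.
- by rewrite -setTD; exact: sigma_algebraCD.
- exact: sigma_algebra0.
Qed.

(** * Complete sets along timelike segments *)

Lemma complete_causally_convex s M x y z : s != 0 -> wedge M = M ->
  M x -> M z -> precedes s x y -> precedes s y z -> M y.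
Proof.
move=> s0 cM Mx Mz xy yz; rewrite -cM => w pw.
(* A point [w] of [perp M] equal or comparable to [y] would be comparable to [x] or to [z]. *)
apply: contrapT => /(not_orth_cases s0)[yw|yw|wy].
- by apply: (precedes_not_orth xy); rewrite yw; apply/orth_sym/pw.
- apply: (precedes_not_orth (precedes_trans xy yw)).
  exact/orth_sym/pw.
- by apply: (precedes_not_orth (precedes_trans wy yz)); exact: pw.
Qed.

(* Otherwise, starting from [x], the last point of the segment from [x] to [y]
   that lies in [M] would precede a point of [D], hence would not be the last
   one by causal convexity. *)
Lemma maximal_in_complete_no_precedes s M D x y : s != 0 -> wedge M = M ->
  D `<=` M -> (forall p, M p -> ~ D p -> ~ perp D p) ->
  M x -> perp D y -> ~ precedes s x y.
Proof.
move=> s0 cM DM mD Mx py xy.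
have nMy : ~ M y.
  move=> My; have nDy : ~ D y by move=> /py[].
  exact: (mD y).
pose d := y - x; pose p (t : R) := x + t *: d.
have pp t t' : t < t' -> precedes s (p t) (p t').
  move=> tt'; rewrite /precedes /p opprD addrACA subrr add0r -scalerBl.
  by apply: timelike_dirZ => //; rewrite subr_gt0.
have p0 : p 0 = x by rewrite /p scale0r addr0.
have p1 : p 1 = y by rewrite /p scale1r addrC subrK.
pose S := [set t : R | M (p t) /\ 0 <= t <= 1].
have S0 : S 0 by split; rewrite ?p0 // lexx ler01.
have Sub : ubound S 1 by move=> t [_ /andP[]].
have supS : has_sup S by split; [exists 0|exists 1].
pose t0 := sup S.
have t00 : 0 <= t0 by apply: ub_le_sup => //; exists 1.
have t01 : t0 <= 1 by apply: ge_sup => //; exists 0.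
(* The supremum is attained: a point [w] of [perp M] not orthogonal to [p t0] must precede it, since
   otherwise [w] is [x] or comes after [x]. By openness [w] then precedes some [p t] in [M] with [t]
   close to [t0]. *)
have Mt0 : M (p t0).
  rewrite -cM => w pw; apply: contrapT.
  have below : ~ precedes s (p t0) w /\ p t0 <> w.
    have [t0E|t0gt] := eqVneq t0 0.
      rewrite t0E p0; split=> [xw|xw].
        by apply: (precedes_not_orth xw); exact/orth_sym/pw.
      by have [] := pw x Mx; rewrite xw.
    have xt0 : precedes s x (p t0).
      by rewrite -p0; apply: pp; rewrite lt_neqAle eq_sym t0gt.
    split=> [tw|tw].
      apply: (precedes_not_orth (precedes_trans xt0 tw)).
      exact/orth_sym/pw.
    by apply: (precedes_not_orth xt0); rewrite tw; exact/orth_sym/pw.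
  case/(not_orth_cases s0) => [tw|tw|wt].
  - exact: below.2.
  - exact: below.1.
  - have [e e0 He] := timelike_dir_open wt xy.
    have [t St tlt] := sup_adherent e0 supS.
    have tle : t <= t0 by apply: ub_le_sup => //; exists 1.
    have wpt : precedes s w (p t).
      rewrite /precedes.
      have -> : p t - w = (p t0 - w) - (t0 - t) *: d.
        by apply/rowP => i; rewrite /p !mxE; ring.
      by apply: He; rewrite subr_ge0 tle /= lerBlDr addrC -lerBlDr ltW.
    by apply: (precedes_not_orth wpt); apply: pw; exact: St.1.
have t0lt1 : t0 < 1.
  rewrite lt_neqAle t01 andbT; apply: contra_notN nMy => /eqP t1.
  by rewrite -p1 -t1.
have pt0y : precedes s (p t0) y by rewrite -p1; exact: pp.
have [nDp ndp] : ~ D (p t0) /\ ~ perp D (p t0).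
  have nD : ~ D (p t0).
    move=> Dp; apply: (precedes_not_orth pt0y); exact/orth_sym/py.
  by split=> //; exact: mD.
apply: ndp => q Dq; apply: contrapT => /(not_orth_cases s0)[pq|pq|qp].
- by apply: nDp; rewrite pq.
- have [e e0 He] := timelike_dir_open pq xy.
  (* The bound [1 - t0] keeps [t0 + e'] in the unit interval, and [e] keeps the shifted point before
     [q]. *)
  pose e' := Num.min e (1 - t0).
  have e'0 : 0 < e' by rewrite lt_min e0 subr_gt0.
  have e'e : e' <= e by rewrite ge_min lexx.
  have e't : e' <= 1 - t0 by rewrite ge_min lexx orbT.
  have lt : t0 < t0 + e' by rewrite ltrDl.
  have Mp : M (p (t0 + e')).
    apply: (complete_causally_convex s0 cM Mt0 (DM _ Dq)); first exact: pp.
    rewrite /precedes.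
    have -> : q - p (t0 + e') = (q - p t0) - e' *: d.
      by apply/rowP => i; rewrite /p !mxE; ring.
    by apply: He; rewrite e'e ltW.
  have : t0 + e' <= t0.
    apply: ub_le_sup; first by exists 1.
    by split=> //; apply/andP; split; lra.
  by rewrite leNgt lt.
- by apply: (precedes_not_orth (precedes_trans qp pt0y)); exact/orth_sym/py.
Qed.

Lemma wedge_maximal_in_complete M D : wedge M = M -> achronal D -> D `<=` M ->
  (forall N, N `<=` M -> achronal N -> D `<=` N -> N = D) -> wedge D = M.
Proof.
move=> cM aD DM maxD.
have mD p : M p -> ~ D p -> ~ perp D p.
  move=> Mp nDp pDp; apply: nDp.
  rewrite -(maxD _ _ (achronalU1 aD pDp)); [by left| |exact: subsetUr].
  by move=> q [->|/DM].
apply/seteqP; split; first by rewrite -cM; do 2 apply: perpS.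
move=> x Mx y py; apply: contrapT.
move=> /(not_orth_cases (oner_neq0 R))[xy|xy|yx].
- by apply: (mD x) => //; [rewrite xy => /py[]|rewrite xy].
- exact: (maximal_in_complete_no_precedes (oner_neq0 R) cM DM mD Mx py).
(* The past case is the future one with the time orientation reversed. *)
- have n1 : -1 != 0 :> R by rewrite oppr_eq0 oner_neq0.
  apply: (maximal_in_complete_no_precedes n1 cM DM mD Mx py).
  case: yx => gt0 t0; split; first by rewrite -mdotNN opprB.
  by rewrite mulN1r -opprB mxE opprK -[X in 0 < X]mul1r.
Qed.

Lemma complete_borel_achronal_hull M : borel M -> wedge M = M ->
  exists D, [/\ borel D, achronal D & wedge D = M].
Proof.
move=> bM cM.
have a0 : achronal (set0 : set 'rV[R]_4) by [].
have [D [_ DM aD maxD]] := achronal_extension a0 (@sub0set _ M).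
have [L DL maxL] := maximal_achronal_extension aD.
exists D; split=> //; last exact: wedge_maximal_in_complete.
(* Zorn's lemma says nothing on measurability of [D]; it comes from [L], whose trace on [M] is
   achronal and contains [D]. *)
have <- : L `&` M = D.
  apply: maxD; first exact: subIsetr.
    exact: (achronalS (@subIsetl _ _ _) maxL.1).
  by move=> x Dx; split; [exact: DL|exact: DM].
exact: borelI (maximal_achronal_borel maxL) bM.
Qed.

(** * The map from achronal Borel sets onto the causal logic *)

Lemma achronalBorel_eq (D E : achronalBorel R) : D = E :> set _ -> D = E.
Proof.
case: D E => [D pD] [E pE] /= DE; move: pD; rewrite DE => pD.
by congr AchronalBorel; exact: Prop_irrelevance.
Qed.

Lemma causalLogic_eq (M N : causalLogic R) : M = N :> set _ -> M = N.
Proof.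
case: M N => [M pM] [N pN] /= MN; move: pM; rewrite MN => pM.
by congr CausalLogic; exact: Prop_irrelevance.
Qed.

Lemma causal_hull_surj (M : causalLogic R) :
  exists D : achronalBorel R, causal_hull D = M.
Proof.
have [bM cM] := causal_setP M.
have [D [bD aD DM]] := complete_borel_achronal_hull bM cM.
by exists (AchronalBorel (conj bD aD)); exact: causalLogic_eq.
Qed.

Lemma orth_sets_disjoint M N : orth_sets M N -> M `&` N = set0.
Proof. by move=> o; rewrite -subset0 => x [Mx Nx]; case: (o _ _ Mx Nx). Qed.

Lemma orth_setsS M M' N N' : M `<=` M' -> N `<=` N' ->
  orth_sets M' N' -> orth_sets M N.
Proof. by move=> MM NN o x y /MM ? /NN ?; exact: o. Qed.

(** [N] lies in [perp M], which is complete, so [wedge N] lies there as well; and [perp M] is also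
    [perp (wedge M)]. *)
Lemma orth_sets_wedge M N : orth_sets M N -> orth_sets (wedge M) (wedge N).
Proof.
move=> o x y wx wy; apply: wx; rewrite -perp_wedge => z wz.
by apply: wy => w Nw; apply: wz => v Mv; exact/orth_sym/o.
Qed.

End CausalGeometry.

(** * Transfer between localizations and representations *)

Section Equivalence.

Set Implicit Arguments.
Unset Strict Implicit.
Unset Printing Implicit Defensive.

Variables (R : realType) (H : completeNormedModType R[i]).
Variable dot : {dot H for Num.conj}.
Implicit Types (T : achronalBorel R -> H -> H) (F : causalLogic R -> H -> H).

(** The normalization is applied to the sequence [D], [E], empty, empty, and so on, whose partial
    sums are constant from index 2 on. *)
Lemma AL_complement T (D E : achronalBorel R) u : AL dot T ->
  D `&` E = set0 -> maximal_achronal (D `|` E) -> T D u + T E u = u.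
Proof.
move=> [_ T0 Tsum] DE maxDE.
pose A n := match n with 0 => D | 1 => E | _ => achronalBorel0 R end.
have A2 : \bigcup_n A n = D `|` E.
  rewrite -bigcup2E; apply: eq_bigcup => // -[|[|n]] //.
have A0 m n : m <> n -> A m `&` A n = set0.
  case: m n => [|[|m]] [|[|n]] //= _; rewrite ?setI0 ?set0I //.
  by rewrite setIC.
have cvgu : series (fun n => T (A n) u) @ \oo --> u.
  by apply: Tsum => //; rewrite A2.
have cvgDE : series (fun n => T (A n) u) @ \oo --> T D u + T E u.
  apply: cvg_near_cst; exists 2 => // -[|[|n]] //= _.
  rewrite /series /= big_nat_recl // big_nat_recl //= big1 ?addr0 //.
  by move=> i _; rewrite T0.
exact: (cvg_unique _ cvgDE cvgu).
Qed.

Lemma AL_causal_hull T (D E : achronalBorel R) :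
  AL dot T -> causal_hull D = causal_hull E -> T D = T E.
Proof.
move=> ALT /(congr1 (@causal_set R)) /= DE.
have pDE : perp D = perp E by rewrite -perp_wedge -[RHS]perp_wedge /wedge DE.
have [bD aD] := achronal_setP D; have [bE aE] := achronal_setP E.
have [L DL maxL] := maximal_achronal_extension aD.
have bG : borel (L `\` D).
  rewrite setDE; apply: borelI; first exact: maximal_achronal_borel.
  by rewrite -setTD; exact: sigma_algebraCD.
have aG : achronal (L `\` D) by apply: achronalS maxL.1 => x [].
pose G := AchronalBorel (conj bG aG).
have GpD : L `\` D `<=` perp D.
  move=> x [Lx nDx] y Dy; apply: (achronal_orth maxL.1) => //; first exact: DL.
  by move=> xy; apply: nDx; rewrite xy.
have GpE : L `\` D `<=` perp E by rewrite -pDE.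
have DG : D `|` L `\` D = L by rewrite setDUK.
have maxEG : maximal_achronal (E `|` L `\` D).
  apply/maximal_achronalP; split.
    apply: orth_achronal => x y [Ex|Gx] [Ey|Gy] xy.
    - exact: (achronal_orth aE).
    - by apply/orth_sym; exact: (GpE _ Gy).
    - exact: (GpE _ Gx).
    - exact: (achronal_orth aG).
  (* The orthocomplement of a union depends only on those of its pieces, so exchanging [D] for [E]
     leaves it empty. *)
  have [_ <-] := (maximal_achronalP L).1 maxL.
  rewrite -{2}DG; apply/seteqP; split=> x px y [y1|y2].
  - suff : perp D x by apply.
    by rewrite pDE => z Ez; apply: px; left.
  - by apply: px; right.
  - suff : perp E x by apply.
    by rewrite -pDE => z Dz; apply: px; left.
  - by apply: px; right.
have EG0 : E `&` (L `\` D) = set0.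
  by rewrite -subset0 => x [Ex Gx]; have [] := GpE _ Gx _ Ex.
apply/funext => u; apply: (addIr (T G u)).
rewrite (@AL_complement T E G u ALT EG0 maxEG).
by apply: AL_complement => /=; rewrite ?setDIK ?DG.
Qed.

(** Distinct points of an achronal set are orthogonal, so disjoint pieces have orthogonal
    completions; by maximality no point is orthogonal to all of them, so their join is the whole
    space. *)
Lemma RCL_AL F : RCL dot F -> AL dot (fun D => F (causal_hull D)).
Proof.
move=> [F1 F0 Fsum]; split=> [D||D disjD maxD]; first exact: F1.
  by rewrite -F0; congr F; apply: causalLogic_eq; exact: wedge0.
apply: Fsum => [m n mn|].
  apply: orth_sets_wedge => x y Dx Dy.
  apply: (achronal_orth maxD.1); [by exists m|by exists n|move=> xy].
  by rewrite -[False]/(set0 x) -(disjD _ _ mn); split=> //; rewrite xy.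
apply: perp_eq0_wedge.
have [_ <-] := (maximal_achronalP _).1 maxD.
rewrite !perp_bigcup; apply: eq_bigcap => // n _.
exact: perp_wedge.
Qed.

(** [F M] is the value of [T] on a chosen achronal Borel set with completion [M]; by
    [AL_causal_hull] the choice does not matter. *)
Lemma AL_extension T : AL dot T -> exists F,
  RCL dot F /\ forall D, F (causal_hull D) = T D.
Proof.
move=> ALT; have [T1 T0 Tsum] := ALT.
have [g gK] := choice (@causal_hull_surj R).
exists (T \o g); split; last by move=> D; exact: (AL_causal_hull ALT (gK _)).
have gE M : wedge (g M) = M by rewrite -[in RHS](gK M).
have gS (M : causalLogic R) : g M `<=` M.
  by rewrite -[X in _ `<=` X]gE; exact: sub_wedge.
split=> [M||M orthM wM] /=; first exact: T1.
  rewrite -T0; congr T; apply: achronalBorel_eq => /=.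
  by rewrite -subset0; exact: gS.
apply: Tsum => [m n mn|].
  exact: (orth_sets_disjoint (orth_setsS (@gS _) (@gS _) (orthM _ _ mn))).
(* Chosen sets from different [M n] are orthogonal, so their union is achronal; its orthocomplement
   is that of the join, hence empty. *)
apply/maximal_achronalP; split.
  apply: orth_achronal => x y [m _ gx] [n _ gy] xy.
  have [mn|/eqP mn] := eqVneq m n; last by apply: (orthM _ _ mn); exact: gS.
  move: gx; rewrite mn => gx.
  exact: (achronal_orth (achronal_setP (g (M n))).2).
rewrite -perp_setT -wM perp_wedge !perp_bigcup; apply: eq_bigcap => // n _.
by rewrite -perp_wedge gE.
Qed.

End Equivalence.

Theorem mainTheorem3 (R : realType) (H : completeNormedModType R[i])
    (dot : {dot H for Num.conj}) (dot_norm : inner_product_norm dot)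
    (sepH : separable H) :
  (forall F : causalLogic R -> H -> H,
     RCL dot F -> AL dot (fun D => F (causal_hull D))) /\
  (forall T : achronalBorel R -> H -> H, AL dot T ->
     exists! F : causalLogic R -> H -> H,
       RCL dot F /\ forall D : achronalBorel R, F (causal_hull D) = T D).
Proof.
split=> [F|T /AL_extension [F [RF FT]]]; first exact: RCL_AL.
exists F; split=> // F' [_ F'T]; apply/funext => M.
by have [D <-] := causal_hull_surj M; rewrite FT F'T.
Qed.
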